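(* Let $\mathbb{K}$ be a field, $S=\mathbb{K}[x_1,\dots,x_n]$, and let $I\subset S$ be a monomial ideal. Then $$\min_{k\geq 1}\{{\rm sdepth}(S/I^k)\} \leq {\rm sdepth}(S/\overline{I})\quad\text{and}\quad \min_{k\geq 1}\{{\rm sdepth}(I^k)\} \leq {\rm sdepth}(\overline{I}),$$ where the minima are taken over all integers $k\geq 1$.
   Context: $S=\mathbb{K}[x_1,\dots,x_n]$ is the polynomial ring over a field $\mathbb{K}$ with its standard $\mathbb{Z}^n$-grading ($\deg x_i=e_i$). Stanley depth: let $M$ be a finitely generated $\mathbb{Z}^n$-graded $S$-module. For a homogeneous element $u\in M$ and a subset $Z\subseteq\{x_1,\dots,x_n\}$, let $u\mathbb{K}[Z]$ be the $\mathbb{K}$-subspace of $M$ generated by all elements $uv$ with $v\in\mathbb{K}[Z]$. It is called a Stanley space of dimension $|Z|$ if it is a free $\mathbb{K}[Z]$-module. A Stanley decomposition $\mathcal{D}$ of $M$ is a decomposition of $M$ (as a $\mathbb{K}$-vector space) as a finite direct sum of Stanley spaces. The Stanley depth ${\rm sdepth}(\mathcal{D})$ is the minimum dimension of a Stanley space in $\mathcal{D}$, and ${\rm sdepth}(M)$ is the maximum of ${\rm sdepth}(\mathcal{D})$ over all Stanley decompositions $\mathcal{D}$ of $M$. Convention: ${\rm sdepth}(0)=\infty$ (empty decomposition). Integral closure: for an ideal $I\subseteq S$, an element $f\in S$ is integral over $I$ if there is an equation $f^m+c_1f^{m-1}+\dots+c_{m-1}f+c_m=0$ with $m\ge 1$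 and $c_i\in I^i$. The integral closure $\overline{I}$ is the set of all elements of $S$ integral over $I$. For a monomial ideal $I$, it is known that $\overline{I}$ is the monomial ideal generated by all monomials $u\in S$ such that $u^m\in I^m$ for some integer $m\geq 1$. *)

(* Defs.v *)
From mathcomp Require Import all_boot all_order all_algebra.
(* mpoly has to be imported before the files of mathcomp-analysis: in the
   other order their notations clash. *)
From mathcomp Require Import mpoly.
From mathcomp Require Import boolp classical_sets constructive_ereal.

Set Implicit Arguments.
Unset Strict Implicit.
Unset Printing Implicit Defensive.

Import Order.TTheory GRing.Theory Num.Theory.
Local Open Scope classical_set_scope.
Local Open Scope ring_scope.

(* Stanley depths live in {0, 1, 2, ...} together with +oo, viewed inside
   \bar int.  The default values are only taken when A has no greatest (resp.
   least) element. *)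
Definition emax (A : set (\bar int)) : \bar int :=
  xget -oo%E (A `&` ubound A).
Definition emin (A : set (\bar int)) : \bar int :=
  xget +oo%E (A `&` lbound A).

Section StanleyDepth.
Variables (K : fieldType) (n : nat).
Local Notation S := {mpoly K[n]}.

(* The subalgebra K[Z] of S. *)
Definition polyZ (Z : {set 'I_n}) : set S :=
  [set p | forall m, m \in msupp p -> forall i, i \notin Z -> m i = 0%N].

(* Let M be a Z^n-graded S-module, with [comp a] its component of degree a, and
   let B be contained in A, both graded submodules of M.  The graded module A/B
   is handled through representatives: its elements are given by elements of A,
   equality being congruence modulo B, and its homogeneous elements of degree a
   are the classes of the elements of A lying in [comp a].  The module M itself
   is the case A = setT, B = [set 0]. *)
Variables (M : lmodType S) (comp : {ffun 'I_n -> int} -> set M) (A B : set M).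

Definition homogeneous : set M := [set u | exists a, comp a u].

(* The elements of M whose class modulo B lies in u K[Z]; the products u v
   with v in K[Z] already form a K-subspace. *)
Definition stanley_span (u : M) (Z : {set 'I_n}) : set M :=
  [set w | exists2 v, polyZ Z v & B (w - v *: u)].

(* W/B has a finite K[Z]-basis.  For W = stanley_span u Z, which is finitely
   generated over K[Z], requiring the basis to be finite is no restriction. *)
Definition free_over (Z : {set 'I_n}) (W : set M) : Prop :=
  exists (r : nat) (b : 'I_r -> M),
  [/\ forall i, W (b i),
      forall w, W w -> exists2 c : 'I_r -> S,
        forall i, polyZ Z (c i) & B (w - \sum_i c i *: b i)
    & forall c : 'I_r -> S, (forall i, polyZ Z (c i)) ->
        B (\sum_i c i *: b i) -> forall i, c i = 0].

Definition stanley_space (u : M) (Z : {set 'I_n}) : Prop :=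
  [/\ A u, homogeneous u & free_over Z (stanley_span u Z)].

Definition stanley_decomposition r (D : 'I_r -> M * {set 'I_n}) : Prop :=
  [/\ forall j, stanley_space (D j).1 (D j).2,
      forall x, A x -> exists2 w : 'I_r -> M,
        forall j, stanley_span (D j).1 (D j).2 (w j) & B (x - \sum_j w j)
    & forall w : 'I_r -> M,
        (forall j, stanley_span (D j).1 (D j).2 (w j)) ->
        B (\sum_j w j) -> forall j, B (w j)].

(* +oo for the empty decomposition *)
Definition sdepth_decomposition r (D : 'I_r -> M * {set 'I_n}) : \bar int :=
  \big[Order.min/+oo%E]_j (#|(D j).2|%:Z)%:E.

Definition sdepth : \bar int :=
  emax [set d | exists (r : nat) (D : 'I_r -> M * {set 'I_n}),
          stanley_decomposition D /\ d = sdepth_decomposition D].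

End StanleyDepth.

Section Ideals.
Variables (K : fieldType) (n : nat).
Local Notation S := {mpoly K[n]}.

Definition ideal_gen (G : set S) : set S :=
  [set f | exists (r : nat) (a g : 'I_r -> S),
     (forall i, G (g i)) /\ f = \sum_i a i * g i].

Definition monomial_ideal (I : set S) : Prop :=
  exists G : set 'X_{1..n}, I = ideal_gen [set 'X_[m] | m in G].

Definition ideal_exp (I : set S) (k : nat) : set S :=
  ideal_gen [set f | exists g : 'I_k -> S,
     (forall i, I (g i)) /\ f = \prod_i g i].

Definition integral_over_ideal (I : set S) (f : S) : Prop :=
  exists m : nat, (0 < m)%N /\
  exists c : nat -> S,
    (forall i, (1 <= i <= m)%N -> ideal_exp I i (c i)) /\
    f ^+ m + \sum_(1 <= i < m.+1) c i * f ^+ (m - i) = 0.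

Definition integral_closure (I : set S) : set S :=
  [set f | integral_over_ideal I f].

Definition mpoly_comp (a : {ffun 'I_n -> int}) : set S^o :=
  [set f : S | forall m, m \in msupp f -> forall i, (m i)%:Z = a i].

(* The Stanley depth of S/J and of J, for a monomial ideal J. *)
Definition sdepth_quotient (J : set S) : \bar int :=
  @sdepth K n S^o mpoly_comp setT J.
Definition sdepth_ideal (J : set S) : \bar int :=
  @sdepth K n S^o mpoly_comp J [set 0].

End Ideals.

(* Main.v *)
Require Import Defs.
From HB Require Import structures.
From mathcomp Require Import all_boot all_order all_algebra.
From mathcomp Require Import mpoly.
From mathcomp Require Import boolp classical_sets constructive_ereal.
From mathcomp Require Import ring.

(** Dickson's lemma gives a single [k > 0] such that a monomial [x^m] is in the
    integral closure of [I] iff [x^(k m)] is in [I^k].  The preimage of a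
    Stanley space [x^a K[Z]] under [m |-> k m] is empty or again of the form
    [x^a' K[Z]], so a Stanley decomposition of [S/I^k] (resp. [I^k]) pulls back
    to one of the quotient by the closure (resp. of the closure) with the same
    sets [Z].

    That the closure of [I] is spanned by the monomials having a power
    [u^k] in [I^k] is proved as follows.  Such monomials are integral, and sums
    of integral elements are integral because [f] is integral over [I] iff [f t]
    is integral over the Rees algebra.  Conversely, if no power of [u] is
    in the matching power of [I], then the differences [w - k u], with [x^w] in
    [I^k], generate a semigroup of Z^n avoiding [0], which extends to the
    positive cone of a total order by Zorn's lemma; comparing the lowest terms
    of an integral equation of [f] shows that every monomial of [f] lies
    strictly above [u]. *)

Set Implicit Arguments.
Unset Strict Implicit.
Unset Printing Implicit Defensive.

Import Order.TTheory GRing.Theory Num.Theory.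
Local Open Scope classical_set_scope.
Local Open Scope ring_scope.

(** * Supports of polynomials and powers of monomial ideals *)

Section MonomialSupport.
Variables (K : fieldType) (n : nat).
Local Notation S := {mpoly K[n]}.
Implicit Types (E : set 'X_{1..n}) (I : set S) (f g p : S) (m : 'X_{1..n}).

(** The K-span of the monomials with exponent in [E]; through it, statements on monomial ideals
    become statements on sets of exponents. *)
Definition supported E : set S := [set f | forall m, m \in msupp f -> E m].

Lemma supportedX E m : supported E 'X_[m] <-> E m.
Proof.
split=> [|Em k]; first by apply; rewrite msuppX inE.
by rewrite msuppX inE => /eqP ->.
Qed.

Lemma supported0 E : supported E 0.
Proof. by move=> m; rewrite msupp0. Qed.

Lemma supportedD E f g : supported E f -> supported E g -> supported E (f + g).
Proof.
by move=> Ef Eg m /msuppD_le; rewrite mem_cat => /orP[/Ef|/Eg].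
Qed.

Lemma supportedZ E c f : supported E f -> supported E (c *: f).
Proof. by move=> Ef m /msuppZ_le/Ef. Qed.

Lemma supportedN E f : supported E f -> supported E (- f).
Proof. by rewrite -scaleN1r; apply: supportedZ. Qed.

Lemma supportedB E f g : supported E f -> supported E g -> supported E (f - g).
Proof. by move=> Ef /supportedN; apply: supportedD. Qed.

Lemma supported_sum E (T : Type) (s : seq T) (P : pred T) (F : T -> S) :
  (forall i, P i -> supported E (F i)) -> supported E (\sum_(i <- s | P i) F i).
Proof.
move=> EF; elim/big_rec: _ => [|i x Pi Ex]; first exact: supported0.
exact: supportedD (EF i Pi) Ex.
Qed.

Lemma supportedM E1 E2 E f g :
    (forall m1 m2, E1 m1 -> E2 m2 -> E (m1 + m2)%MM) ->
  supported E1 f -> supported E2 g -> supported E (f * g).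
Proof.
move=> E12 Ef Eg m /msuppM_le /allpairsP[[m1 m2] /= [/Ef e1 /Eg e2 ->]].
exact: E12.
Qed.

Lemma sub_supported E1 E2 : E1 `<=` E2 -> supported E1 `<=` supported E2.
Proof. by move=> sE f Ef m /Ef/sE. Qed.

Lemma supportedT : supported setT = setT.
Proof. by apply/seteqP; split. Qed.

Lemma supported_set0 : supported set0 = [set 0].
Proof.
apply/seteqP; split=> [f Ef|_ ->]; last exact: supported0.
by apply/mpolyP => m; rewrite mcoeff0; apply/memN_msupp_eq0/negP => /Ef.
Qed.

Lemma ideal_gen0 (G : set S) : ideal_gen G 0.
Proof. by exists 0, (fun=> 0), (fun=> 0); split=> [[]//|]; rewrite big_ord0. Qed.

Lemma ideal_gen_incl (G : set S) g : G g -> ideal_gen G g.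
Proof.
move=> Gg; exists 1, (fun=> 1), (fun=> g).
by split=> //; rewrite big_ord1 mul1r.
Qed.

Lemma ideal_genM (G : set S) p f : ideal_gen G f -> ideal_gen G (p * f).
Proof.
move=> [r [a [g [Gg ->]]]]; exists r, (fun i => p * a i), g; split=> //.
by rewrite mulr_sumr; apply: eq_bigr => i _; rewrite mulrA.
Qed.

Lemma ideal_genD (G : set S) f g :
  ideal_gen G f -> ideal_gen G g -> ideal_gen G (f + g).
Proof.
move=> [r [a [u [Gu ->]]]] [s [b [v [Gv ->]]]].
exists (r + s)%N, (fun i => match split i with inl j => a j | inr j => b j end),
  (fun i => match split i with inl j => u j | inr j => v j end).
split=> [i|]; first by case: (split i).
rewrite big_split_ord /=; congr (_ + _); apply: eq_bigr => i _.
  by rewrite (unsplitK (inl i)).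
by rewrite (unsplitK (inr i)).
Qed.

Lemma ideal_gen_sum (G : set S) (T : Type) (s : seq T) (P : pred T)
    (F : T -> S) :
  (forall i, P i -> ideal_gen G (F i)) -> ideal_gen G (\sum_(i <- s | P i) F i).
Proof.
move=> GF; elim/big_rec: _ => [|i x Pi Gx]; first exact: ideal_gen0.
exact: ideal_genD (GF i Pi) Gx.
Qed.

Lemma ideal_gen_monomials (G : set S) f :
  supported [set m | ideal_gen G 'X_[m]] f -> ideal_gen G f.
Proof.
move=> Gf; rewrite [f]mpolyE big_seq; apply: ideal_gen_sum => m /Gf Gm.
by rewrite -mul_mpolyC; apply: ideal_genM.
Qed.

Lemma ideal_exp0 I f : ideal_exp I 0 f.
Proof.
rewrite -[f]mulr1; apply/ideal_genM/ideal_gen_incl.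
by exists (fun=> 0); split=> [[]//|]; rewrite big_ord0.
Qed.

Lemma ideal_exp1 I f : I f -> ideal_exp I 1 f.
Proof.
by move=> If; apply: ideal_gen_incl; exists (fun=> f); rewrite big_ord1.
Qed.

Lemma ideal_expM I i j f g :
  ideal_exp I i f -> ideal_exp I j g -> ideal_exp I (i + j) (f * g).
Proof.
move=> [r [a [u [Iu ->]]]] [s [b [v [Iv ->]]]].
rewrite mulr_suml; apply: ideal_gen_sum => x _.
rewrite mulr_sumr; apply: ideal_gen_sum => y _.
rewrite mulrACA; apply/ideal_genM/ideal_gen_incl.
have [g1 [Ig1 ->]] := Iu x; have [g2 [Ig2 ->]] := Iv y.
exists (fun i => match split i with inl j => g1 j | inr j => g2 j end).
split=> [k|]; first by case: (split k).
rewrite big_split_ord /=; congr (_ * _); apply: eq_bigr => k _.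
  by rewrite (unsplitK (inl k)).
by rewrite (unsplitK (inr k)).
Qed.

Lemma ideal_expX I i k f : ideal_exp I i f -> ideal_exp I (i * k) (f ^+ k).
Proof.
move=> If; elim: k => [|k IHk]; first by rewrite muln0; apply: ideal_exp0.
by rewrite exprS mulnS; apply: ideal_expM.
Qed.

Definition exp_monomials I k : set 'X_{1..n} :=
  [set m | ideal_exp I k 'X_[m]].

Lemma exp_monomialsD I i j m1 m2 :
    exp_monomials I i m1 -> exp_monomials I j m2 ->
  exp_monomials I (i + j) (m1 + m2)%MM.
Proof. by move=> I1 I2; rewrite /exp_monomials /= mpolyXD; apply: ideal_expM. Qed.

Lemma exp_monomials_addl I k m1 m2 :
  exp_monomials I k m2 -> exp_monomials I k (m1 + m2)%MM.
Proof. by rewrite /exp_monomials /= mpolyXD; apply: ideal_genM. Qed.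

Lemma exp_monomialsX I i k m :
  exp_monomials I i m -> exp_monomials I (i * k) (m *+ k)%MM.
Proof. by move=> Im; rewrite /exp_monomials /= -mpolyXn; apply: ideal_expX. Qed.

Lemma monomial_ideal_supported I f :
  monomial_ideal I -> I f -> supported [set m | I 'X_[m]] f.
Proof.
move=> [G ->] [r [a [g [Gg ->]]]]; apply: supported_sum => i _.
have [m Gm <-] := Gg i.
apply: (@supportedM setT [set m]) => // [m1 _ _ ->|].
  by rewrite /= mpolyXD; apply/ideal_genM/ideal_gen_incl; exists m.
by apply/supportedX.
Qed.

(** Each of the [k] factors of a generator of I^k is supported in the monomials of [I], so by
    induction on [k] their product is supported in the monomials of I^k. *)
Lemma ideal_exp_supported I k :
  monomial_ideal I -> ideal_exp I k = supported (exp_monomials I k).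
Proof.
move=> hI; apply/seteqP; split=> f; last exact: ideal_gen_monomials.
move=> [r [a [g [Gg ->]]]]; apply: supported_sum => i _.
apply: (@supportedM setT (exp_monomials I k)) => // [m1 m2 _|].
  exact: exp_monomials_addl.
have [h [Ih ->]] := Gg i; elim: k h Ih {Gg} => [|k IHk] h Ih.
  by move=> m _; apply: ideal_exp0.
rewrite big_ord_recl; apply: supportedM (monomial_ideal_supported hI (Ih _)) (IHk _ _).
  by move=> m1 m2 /ideal_exp1; apply: exp_monomialsD.
by move=> j; apply: Ih.
Qed.

End MonomialSupport.

(** * Extending strict cones to total orders *)

Section PositiveCones.
Variable V : zmodType.
Implicit Types (C D : set V) (x y : V).

(** The positive elements of a translation-invariant strict partial order, x < y meaning that y - x
    is in [C]. *)
Definition strict_cone C : Prop :=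
  (forall x y, C x -> C y -> C (x + y)) /\ ~ C 0.

Lemma strict_coneMn D k x : strict_cone D -> (0 < k)%N -> D x -> D (x *+ k).
Proof.
move=> [DD _] + Dx; elim: k => // -[_|k IHk _]; first by rewrite mulr1n.
by rewrite mulrS; apply: DD Dx (IHk _).
Qed.

Hypothesis torsion_free : forall x k, (0 < k)%N -> x *+ k = 0 -> x = 0.

(** A maximal strict cone [D] containing [C] is total: if a nonzero [a] is outside [D], adjoining it
    must produce 0, so some -pa with p > 0 is in [D]. This cannot happen for both x and -x. *)
Lemma strict_cone_total C : strict_cone C ->
  exists D, [/\ strict_cone D, C `<=` D & forall x, x = 0 \/ D x \/ D (- x)].
Proof.
move=> coneC.
(* The empty chain has union [set0], so Zorn's lemma is applied to the sets to be added to [C] and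
   not to the cones themselves. *)
have [|A [coneA maxA]] := @Zorn_bigcup V [set X | strict_cone (C `|` X)].
  move=> F coneF totF; split=> [x y|[|[X FX X0]]]; last 2 first.
  - exact: coneC.2.
  - by apply: (coneF X FX).2; right.
  have sub X : F X -> C `|` X `<=` C `|` \bigcup_(Y in F) Y.
    by move=> FX z [Cz|Xz]; [left|right; exists X].
  move=> [Cx|[X FX Xx]] [Cy|[Y FY Yy]].
  - by left; apply: coneC.1.
  - by apply: (sub Y FY); apply: (coneF Y FY).1; [left|right].
  - by apply: (sub X FX); apply: (coneF X FX).1; [right|left].
  - have [XY|YX] := totF _ _ FX FY.
      by apply: (sub Y FY); apply: (coneF Y FY).1; right => //; apply: XY.
    by apply: (sub X FX); apply: (coneF X FX).1; right => //; apply: YX.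
set D := C `|` A in coneA.
have step a : a <> 0 -> ~ D a -> exists2 p, (0 < p)%N & D (- a *+ p).
  move=> a0 Da.
  (* The cone generated by [D] and [a]; it meets [0] by maximality of [A]. *)
  pose B := D `|` [set x | exists2 p, (0 < p)%N & x = a *+ p \/ D (x - a *+ p)].
  have CB : C `|` B = B by apply/seteqP; split=> [z [Cz|//]|z]; [left; left|right].
  have : ~ strict_cone (C `|` B).
    apply: maxA; split=> [z Az|BA]; first by left; right.
    by apply: Da; right; apply: BA; right; exists 1%N => //; left; rewrite mulr1n.
  rewrite CB => nB; apply: contrapT => Na; apply: nB; split.
    move=> x y [Dx|[p p0 ex]] [Dy|[q q0 ey]].
    - by left; apply: coneA.1.
    - right; exists q => //; right; case: ey => [->|ey]; first by rewrite addrK.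
      by rewrite -addrA; apply: coneA.1.
    - right; exists p => //; right; case: ex => [->|ex].
        by rewrite addrAC subrr add0r.
      by rewrite addrAC; apply: coneA.1.
    - right; exists (p + q)%N; first by rewrite addn_gt0 p0.
      rewrite mulrnDr opprD addrACA; case: ex ey => [->|ex] [->|ey].
      + by left.
      + by right; rewrite subrr add0r.
      + by right; rewrite subrr addr0.
      + by right; apply: coneA.1.
  move=> [|[p p0 [e0|]]]; first exact: coneA.2.
    by apply: a0; apply: torsion_free p0 _.
  by rewrite sub0r => Dp; apply: Na; exists p => //; rewrite mulNrn.
exists D; split=> // [z Cz|x]; first by left.
have [->|x0] := pselect (x = 0); [by left|right].
have [Dx|Dx] := pselect (D x); [by left|right].
apply: contrapT => DNx.
have [p p0 Dp] := step x x0 Dx.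
have [|q q0] := step (- x) _ DNx; first by move=> e; apply: x0; rewrite -[x]opprK e oppr0.
rewrite opprK => Dq; apply: coneA.2.
(* With -px and qx in [D], the sum of q(-px) and p(qx) is 0 and lies in [D]. *)
have := coneA.1 _ _ (strict_coneMn coneA q0 Dp) (strict_coneMn coneA p0 Dq).
by rewrite -!mulrnA mulnC mulNrn addNr.
Qed.

End PositiveCones.

(** * Exponents as vectors of Z^n, where they can be subtracted *)

Section ExponentVectors.
Variable n : nat.
Implicit Types m : 'X_{1..n}.

Lemma mulmnD m j k : (m *+ (j + k))%MM = (m *+ j + m *+ k)%MM.
Proof. by apply/mnmP => i; rewrite mnmDE !mulmnE mulnDr. Qed.

Lemma mulmnDl m1 m2 k : ((m1 + m2) *+ k)%MM = (m1 *+ k + m2 *+ k)%MM.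
Proof. by apply/mnmP => i; rewrite mnmDE !mulmnE mnmDE mulnDl. Qed.

Lemma mulmnM m j k : (m *+ (j * k))%MM = ((m *+ j) *+ k)%MM.
Proof. by apply/mnmP => i; rewrite !mulmnE mulnA. Qed.

Definition mvec m : {ffun 'I_n -> int} := [ffun i => (m i)%:Z].

Lemma mvecD m1 m2 : mvec (m1 + m2)%MM = mvec m1 + mvec m2.
Proof. by apply/ffunP => i; rewrite !ffunE mnmDE PoszD. Qed.

Lemma mvec0 : mvec 0%MM = 0.
Proof. by apply/ffunP => i; rewrite !ffunE mnm0E. Qed.

Lemma mvecMn m k : mvec (m *+ k)%MM = mvec m *+ k.
Proof.
elim: k => [|k IHk]; first by rewrite mulm0n mvec0.
by rewrite mulmS mvecD IHk mulrS.
Qed.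

Lemma mvec_inj : injective mvec.
Proof.
by move=> m1 m2 /ffunP e; apply/mnmP => i; have := e i; rewrite !ffunE => -[].
Qed.

Lemma ffun_int_torsion_free (x : {ffun 'I_n -> int}) k :
  (0 < k)%N -> x *+ k = 0 -> x = 0.
Proof.
move=> k0 /ffunP xk; apply/ffunP => i; have /eqP := xk i.
by rewrite ffunMnE !ffunE mulrn_eq0 eqn0Ngt k0 => /eqP.
Qed.

End ExponentVectors.

(** * Lowest terms of polynomials for an additive order *)

Section LowestTerm.
Variables (K : fieldType) (n : nat) (D : set {ffun 'I_n -> int}).
Hypothesis coneD : strict_cone D.
Local Notation S := {mpoly K[n]}.
Implicit Types (f g : S) (m u v w : 'X_{1..n}).

(** This is v < u for the order with positive cone [D]. *)
Definition above v : set 'X_{1..n} := [set u | D (mvec u - mvec v)].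

Lemma aboveD v w u1 u2 : above v u1 -> above w u2 -> above (v + w)%MM (u1 + u2)%MM.
Proof. by rewrite /above /= !mvecD opprD addrACA => ? ?; apply: coneD.1. Qed.

Lemma aboveDr v w u : above v u -> above (v + w)%MM (u + w)%MM.
Proof. by rewrite /above /= !mvecD opprD addrACA subrr addr0. Qed.

Lemma aboveDl v w u : above v u -> above (w + v)%MM (w + u)%MM.
Proof. by rewrite ![(w + _)%MM]addmC; apply: aboveDr. Qed.

Lemma above_trans u v w : above v u -> above w v -> above w u.
Proof.
move=> vu wv; have := coneD.1 _ _ vu wv.
by rewrite /above /= addrA subrK.
Qed.

Lemma aboveMn u v k : (0 < k)%N -> above v u -> above (v *+ k)%MM (u *+ k)%MM.
Proof.
by move=> k0; rewrite /above /= !mvecMn -mulrnBl; apply: strict_coneMn.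
Qed.

Definition weakly_above v : set 'X_{1..n} := v |` above v.

Definition lowest v f : Prop := f@_v != 0 /\ supported (weakly_above v) f.

Lemma above_coeff0 v f : supported (above v) f -> f@_v = 0.
Proof.
by move=> vf; apply/memN_msupp_eq0/negP => /vf; rewrite /above /= subrr => /coneD.2.
Qed.

Lemma supported_aboveM v w f g : supported (above v) f ->
  supported (weakly_above w) g -> supported (above (v + w)%MM) (f * g).
Proof.
apply: supportedM => m1 m2 vm1 [->|wm2]; first exact: aboveDr.
exact: aboveD.
Qed.

Lemma lowest_tail v f : lowest v f -> supported (above v) (f - f@_v *: 'X_[v]).
Proof.
move=> [_ vf] m; rewrite mcoeff_msupp mcoeffB mcoeffZ mcoeffX.
case: (eqVneq v m) => [->|vm]; first by rewrite mulr1 subrr eqxx.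
rewrite mulr0 subr0 -mcoeff_msupp => /vf[mv|//].
by rewrite mv eqxx in vm.
Qed.

Lemma lowestM v w f g : lowest v f -> lowest w g -> lowest (v + w)%MM (f * g).
Proof.
move=> lf lg; split; last first.
  apply: supportedM lf.2 lg.2 => m1 m2 [->|vm1] [->|wm2]; first by left.
  - by right; apply: aboveDl.
  - by right; apply: aboveDr.
  - by right; apply: aboveD.
set A := f@_v *: 'X_[v]; set B := g@_w *: 'X_[w].
(* The product of the two lowest terms is split off; the rest lies strictly above v + w and cannot
   cancel it. *)
have -> : f * g = A * B + ((f - A) * g + (g - B) * A) by ring.
rewrite mcoeffD [X in _ + X]above_coeff0 ?addr0.
  rewrite -scalerAl -scalerAr -mpolyXD !mcoeffZ mcoeffX eqxx mulr1.
  by rewrite mulf_neq0 ?lf.1 ?lg.1.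
apply: supportedD; first exact: supported_aboveM (lowest_tail lf) lg.2.
rewrite addmC; apply: supported_aboveM (lowest_tail lg) _.
by apply: supportedZ; apply/supportedX; left.
Qed.

Lemma lowest1 : lowest 0%MM 1.
Proof.
by rewrite -mpolyX0; split; [rewrite mcoeffX eqxx oner_neq0 | apply/supportedX; left].
Qed.

Lemma lowestX v f k : lowest v f -> lowest (v *+ k)%MM (f ^+ k).
Proof.
move=> lf; elim: k => [|k IHk]; first by rewrite mulm0n; apply: lowest1.
by rewrite exprS mulmS; apply: lowestM.
Qed.

Hypothesis totalD : forall x, x = 0 \/ D x \/ D (- x).

Lemma lowest_exists f : f != 0 -> exists v, lowest v f.
Proof.
move=> f0; suff [v vf vmin] : exists2 v, v \in msupp f &
    forall u, u \in msupp f -> weakly_above v u.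
  by exists v; split=> //; rewrite -mcoeff_msupp.
have: msupp f != [::] by rewrite msupp_eq0.
elim: (msupp f) => // m s IHs _.
have [->|/IHs[v vs vmin]] := eqVneq s [::].
  by exists m => [|u]; rewrite ?mem_head// inE => /eqP ->; left.
have total : weakly_above v m \/ above m v.
  have [/subr0_eq/mvec_inj->|[vm|]] := totalD (mvec m - mvec v).
  - by left; left.
  - by left; right.
  - by rewrite opprB; right.
have [vm|mv] := total.
  by exists v => [|u]; rewrite inE ?vs ?orbT// => /predU1P[->|/vmin].
exists m => [|u]; rewrite inE ?eqxx// => /predU1P[->|/vmin[->|vu]]; first by left.
  by right.
by right; apply: above_trans vu mv.
Qed.

(** If [u] were in the support, the lowest exponent [v] of [f] would be at most [u], so every
    exponent of I^k with k > 0 would exceed kv. Each c_i f^(m-i) with i > 0 then lies strictly above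
    mv, while f^m has a nonzero coefficient there, so the equation fails. *)
Lemma integral_support_nabove I f u :
    monomial_ideal I -> integral_over_ideal I f ->
    (forall k w, (0 < k)%N -> exp_monomials I k w -> above (u *+ k)%MM w) ->
  u \notin msupp f.
Proof.
move=> hI [m [m0 [c [Ic eq0]]]] aboveI; apply/negP => uf.
have f0 : f != 0 by apply: contraTneq uf => ->; rewrite msupp0.
have [v lf] := lowest_exists f0.
have abovev k w : (0 < k)%N -> exp_monomials I k w -> above (v *+ k)%MM w.
  move=> k0 Iw; have := aboveI k w k0 Iw; have [<-//|vu] := lf.2 u uf.
  by move/above_trans; apply; apply: aboveMn.
have /eqP[] := (lowestX m lf).1.
rewrite -[f ^+ m](addrK (\sum_(1 <= i < m.+1) c i * f ^+ (m - i))) eq0 sub0r.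
apply: above_coeff0; apply: supportedN; rewrite big_nat_cond.
apply: supported_sum => i /andP[/andP[i1 im] _].
rewrite -{1}(subnKC (im : i <= m)%N) mulmnD.
apply: supported_aboveM (lowestX _ lf).2.
have := Ic i; rewrite i1 -ltnS im => /(_ isT); rewrite ideal_exp_supported//.
by apply: sub_supported => w; apply: abovev.
Qed.
End LowestTerm.

(** * Monomials of integral elements *)

Section IntegralClosure.
Variables (K : fieldType) (n : nat) (I : set {mpoly K[n]}).
Hypothesis hI : monomial_ideal I.
Local Notation S := {mpoly K[n]}.
Implicit Types (f g : S) (m u v w : 'X_{1..n}).

Definition power_monomials : set 'X_{1..n} :=
  [set u | exists2 k, (0 < k)%N & exp_monomials I k (u *+ k)%MM].

Lemma integral_closure_power f :
  integral_over_ideal I f -> supported power_monomials f.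
Proof.
move=> intf u; apply: contraTP => nPu.
(* The set [C] contains 0 exactly when some positive power of x^u lies in the matching power of [I].
   A total order making [C] positive puts all exponents of I^k above ku. *)
pose C := [set x | exists k w,
  [/\ (0 < k)%N, exp_monomials I k w & x = mvec w - mvec (u *+ k)%MM]].
have coneC : strict_cone C.
  split=> [x y [k [w [k0 Iw ->]]] [l [z [_ Iz ->]]]|[k [w [k0 Iw /esym]]]].
    exists (k + l)%N, (w + z)%MM; split; first by rewrite addn_gt0 k0.
      exact: exp_monomialsD.
    by rewrite mulmnD !mvecD opprD addrACA.
  by move/subr0_eq/mvec_inj => e; apply: nPu; exists k; rewrite -?e.
have [D [coneD CD totD]] := strict_cone_total (@ffun_int_torsion_free n) coneC.
apply: integral_support_nabove coneD totD _ _ _ hI intf _ => k w k0 Iw.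
by apply: CD; exists k, w.
Qed.

End IntegralClosure.

(** * Integrality of sums through the Rees algebra *)

Lemma integral_of_exp (A B : nzRingType) (phi : {rmorphism A -> B}) z k c :
  (0 < k)%N -> z ^+ k = phi c -> integralOver phi z.
Proof.
move=> k0 zk; exists ('X^k - c%:P); first exact: monicXnsubC.
rewrite rmorphB /= map_polyXn map_polyC /= rootE hornerD hornerN hornerXn hornerC.
by rewrite zk subrr.
Qed.

Section ReesAlgebra.
Variables (K : fieldType) (n : nat) (I : set {mpoly K[n]}).
Local Notation S := {mpoly K[n]}.

(** The direct sum of the I^i t^i inside S[t], with t the variable ['X]. It turns integrality over
    an ideal into integrality over a ring, which is stable under sums. *)
Definition rees : {pred {poly S}} := fun p => `[< forall i, ideal_exp I i p`_i >].

Lemma reesP (p : {poly S}) : reflect (forall i, ideal_exp I i p`_i) (p \in rees).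
Proof. exact: asboolP. Qed.

Fact rees_subring_closed : subring_closed rees.
Proof.
split=> [|p q /reesP Ip /reesP Iq|p q /reesP Ip /reesP Iq]; apply/reesP => i.
- by rewrite coef1; case: i => [|i]; [apply: ideal_exp0 | apply: ideal_gen0].
- by rewrite coefB -mulN1r; apply: ideal_genD (Ip i) (ideal_genM _ (Iq i)).
- rewrite coefM; apply: ideal_gen_sum => j _.
  by have := ideal_expM (Ip j) (Iq (i - j)%N); rewrite subnKC// leq_ord.
Qed.

HB.instance Definition _ :=
  GRing.isSubringClosed.Build {poly S} rees rees_subring_closed.

Definition rees_algebra := {p : {poly S} | p \in rees}.
HB.instance Definition _ := [isSub of rees_algebra for sval].
HB.instance Definition _ := [Choice of rees_algebra by <:].
HB.instance Definition _ := [SubChoice_isSubComNzRing of rees_algebra by <:].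

Local Notation val_rees := (\val : rees_algebra -> {poly S}).

(* The coefficient of [t^m] in a monic equation of degree [m] for [f t] is an
   integral equation for [f] over [I]. *)
Lemma integral_over_ideal_rees f :
  integralOver val_rees (f *: 'X) -> integral_over_ideal I f.
Proof.
move=> [q monq]; set p := map_poly _ q => /rootP p0.
have monp : p \is monic by apply: monic_map.
have reesp j : p`_j \in rees by rewrite coef_map; apply: valP.
have sp : size p = (size p).-1.+1.
  by rewrite prednK// lt0n size_poly_eq0 monic_neq0.
set m := (size p).-1 in sp.
have plead : p`_m = 1 by move/monicP: monp.
move/(congr1 (fun r : {poly S} => r`_m)): p0.
rewrite horner_coef sp coef0 coef_sum.
under eq_bigr => j _ do
  rewrite exprZn -scalerAr coefZ coefMXn ltnNge leq_ord /= mulrC.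
rewrite big_ord_recr /= plead subnn coef1 mul1r => eq0.
(* In degree 0 the monic equation would read 1 = 0. *)
have m0 : (0 < m)%N.
  case: m eq0 {sp plead} => // /eqP.
  by rewrite big_ord0 add0r expr0 oner_eq0.
(* The coefficient of t^i in an element of the Rees algebra is in I^i, as required of c_i. *)
exists m; split=> //; exists (fun i => (p`_(m - i))`_i); split.
  by move=> i _; apply/reesP.
rewrite addrC -{}[RHS]eq0; congr (_ + _).
rewrite big_add1 /= big_mkord (reindex_inj rev_ord_inj) /=.
by apply: eq_bigr => i _; rewrite !subnSK// subKn// ltnW.
Qed.

(** The power (f t)^k = f^k t^k is itself an element of the Rees algebra. *)
Lemma integral_rees_power f k :
  (0 < k)%N -> ideal_exp I k (f ^+ k) -> integralOver val_rees (f *: 'X).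
Proof.
move=> k0 Ifk; have reesfk : f ^+ k *: 'X^k \in rees.
  apply/reesP => i; rewrite coefZ coefXn.
  by case: eqP => [->|_]; rewrite ?mulr1 // mulr0; apply: ideal_gen0.
have zk : (f *: 'X) ^+ k = val_rees (exist (fun p => p \in rees) _ reesfk) by rewrite exprZn.
exact: integral_of_exp k0 zk.
Qed.

Lemma integral_closure_monomials f :
  supported (power_monomials I) f -> integral_over_ideal I f.
Proof.
move=> Pf; apply: integral_over_ideal_rees.
rewrite [f]mpolyE scaler_suml big_seq.
elim/big_rec: _ => [|m x /Pf[k k0 Ik] intx]; first exact: integral0.
apply: integral_add => //; apply: integral_rees_power k0 _.
by rewrite -mul_mpolyC exprMn mpolyXn; apply: ideal_genM.
Qed.

End ReesAlgebra.

(** * Dickson's lemma *)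

(** Induction on the list of compared coordinates. Let [s0] serve for [l]. An exponent whose
    coordinate [j] is at least the maximum of that coordinate on [s0] is already bounded below by
    [s0]; the finitely many smaller values of coordinate [j] give slices to which the induction
    hypothesis applies. *)
Lemma dickson_coords n (l : seq 'I_n) (G : set 'X_{1..n}) :
  exists s : seq 'X_{1..n}, (forall m, m \in s -> G m) /\
    (forall m, G m -> exists2 m', m' \in s & forall i, i \in l -> (m' i <= m i)%N).
Proof.
elim: l G => [|j l IHl] G.
  have [[m Gm]|G0] := pselect (exists m, G m).
    exists [:: m]; split=> [m'|m' _]; first by rewrite inE => /eqP ->.
    by exists m; rewrite ?mem_head.
  by exists [::]; split=> // m Gm; case: G0; exists m.
have [s0 [s0G Gs0]] := IHl G.
suff H N : exists s : seq 'X_{1..n}, (forall m, m \in s -> G m) /\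
    (forall m, G m -> (m j < N)%N ->
       exists2 m', m' \in s & forall i, i \in j :: l -> (m' i <= m i)%N).
  have [s [sG Gs]] := H (\max_(m <- s0) m j)%N.
  exists (s0 ++ s); split=> [m|m Gm]; first by rewrite mem_cat => /orP[/s0G|/sG].
  have [/(Gs m Gm)[m' m's le]|big] := ltnP (m j) (\max_(m' <- s0) m' j)%N.
    by exists m' => //; rewrite mem_cat m's orbT.
  have [m' m's le] := Gs0 m Gm; exists m'; first by rewrite mem_cat m's.
  move=> i; rewrite inE => /predU1P[->|/le//].
  by apply: leq_trans big; apply: leq_bigmax_seq m's _.
elim: N => [|N [s [sG Gs]]]; first by exists [::].
have [s' [s'G Gs']] := IHl [set m | G m /\ m j = N].
exists (s ++ s'); split=> [m|m Gm]; first by rewrite mem_cat => /orP[/sG|/s'G[]].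
rewrite ltnS leq_eqVlt => /predU1P[mN|/(Gs m Gm)[m' m's le]].
  have [m' m's le] := Gs' m (conj Gm mN).
  exists m'; first by rewrite mem_cat m's orbT.
  move=> i; rewrite inE => /predU1P[->|/le//].
  by rewrite mN; have [_ ->] := s'G _ m's.
by exists m' => //; rewrite mem_cat m's.
Qed.

Lemma dickson n (G : set 'X_{1..n}) : exists s : seq 'X_{1..n},
  (forall m, m \in s -> G m) /\
  (forall m, G m -> exists2 m', m' \in s & (m' <= m)%MM).
Proof.
have [s [sG Gs]] := dickson_coords (enum 'I_n) G.
exists s; split=> // m /Gs[m' m's le]; exists m' => //.
by apply/mnm_lepP => i; apply: le; rewrite mem_enum.
Qed.

(** * One exponent for the whole integral closure *)

Section UniformPower.
Variables (K : fieldType) (n : nat) (I : set {mpoly K[n]}).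

(** Each exponent of the finite set from Dickson's lemma has its own [k], and the product of these
    serves all of them. It then serves every exponent above one of them, because I^k absorbs
    multiples. *)
Lemma power_monomials_uniform : exists2 k, (0 < k)%N &
  power_monomials I = [set m | exp_monomials I k (m *+ k)%MM].
Proof.
have [s [sP Ps]] := dickson (power_monomials I).
have [k k0 Ik] : exists2 k, (0 < k)%N &
    forall m, m \in s -> exp_monomials I k (m *+ k)%MM.
  elim: s sP {Ps} => [|m s IHs] sP; first by exists 1%N.
  have [k k0 Ik] := IHs (fun m' m's => sP m' (mem_behead (m's : m' \in behead (m :: s)))).
  have [l l0 Il] := sP m (mem_head _ _).
  exists (l * k)%N; first by rewrite muln_gt0 l0.
  move=> m'; rewrite inE => /predU1P[->|m's].
    by rewrite mulmnM; apply: exp_monomialsX.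
  by rewrite mulnC mulmnM; apply/exp_monomialsX/Ik.
exists k => //; apply/seteqP; split=> m => [/Ps[m' /Ik Im' /submK <-]|Im].
  by rewrite /= mulmnDl; apply: exp_monomials_addl.
by exists k.
Qed.

Lemma integral_closure_supported : monomial_ideal I ->
  exists2 k, (0 < k)%N & integral_closure I =
    supported [set m | exp_monomials I k (m *+ k)%MM].
Proof.
move=> hI; have [k k0 Pk] := power_monomials_uniform; exists k => //.
rewrite -Pk; apply/seteqP; split=> f; first exact: integral_closure_power.
exact: integral_closure_monomials.
Qed.

End UniformPower.

(** * Boxes of exponents and their preimages under scaling *)

Section Boxes.
Variable n : nat.
Implicit Types (m a z : 'X_{1..n}) (Z : {set 'I_n}) (T E : set 'X_{1..n}).

Definition mnm_over Z : set 'X_{1..n} := [set z | forall i, i \notin Z -> z i = 0%N].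

(** The exponents of the monomials in x^a K[Z]. *)
Definition box a Z : set 'X_{1..n} :=
  [set m | forall i, (a i <= m i)%N /\ (i \notin Z -> m i = a i)].

Lemma boxP a Z m : box a Z m <-> exists2 z, mnm_over Z z & m = (z + a)%MM.
Proof.
split=> [am|[z Zz ->] i]; last first.
  by rewrite mnmDE leq_addl; split=> // /Zz ->.
exists (m - a)%MM => [i iZ|]; last first.
  by rewrite submK//; apply/mnm_lepP => i; have [] := am i.
by rewrite mnmBE; have [_ ->] := am i; rewrite ?subnn.
Qed.

Lemma box_corner a Z : box a Z a.
Proof. by move=> i. Qed.

(* The corner of the preimage is a / k, rounded up. *)
Lemma box_preimage a Z k m0 : (0 < k)%N -> box a Z (m0 *+ k)%MM ->
  exists a', [set m | box a Z (m *+ k)%MM] = box a' Z.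
Proof.
move=> k0 bm0; exists [multinom (a i + k.-1) %/ k | i < n].
have ceilP i x : ((a i + k.-1) %/ k <= x)%N = (a i <= x * k)%N.
  by rewrite -ltnS ltn_divLR// mulSn addnC -{2}(prednK k0) addSn ltnS leq_add2l.
apply/seteqP; split=> m am i; have [le eq] := am i.
  rewrite mnmE ceilP -mulmnE; split=> // iZ.
  by rewrite -(eq iZ) mulmnE divnMDl// divn_small ?addn0// prednK.
move: le eq; rewrite mnmE ceilP mulmnE => le eq; split=> // iZ.
(* Outside [Z] the box is constant, so the given point k m0 forces [k] to divide a_i there and the
   rounding is exact. *)
have [_ /(_ iZ)] := bm0 i; rewrite mulmnE => am0.
by rewrite eq// -am0 divnMDl// divn_small ?addn0// prednK.
Qed.

(** Empty pieces are allowed because a box may have an empty preimage, while the index set and the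
    sets [Z] have to be kept. *)
Definition box_partition E r (Z : 'I_r -> {set 'I_n}) (T : 'I_r -> set 'X_{1..n}) :=
  [/\ forall j, T j = set0 \/ exists a, T j = box a (Z j),
      forall m, E m <-> exists j, T j m
    & forall i j m, T i m -> T j m -> i = j].

Lemma box_partition_preimage E r (Z : 'I_r -> {set 'I_n})
    (T : 'I_r -> set 'X_{1..n}) k :
    (0 < k)%N -> box_partition E Z T ->
  box_partition [set m | E (m *+ k)%MM] Z (fun j => [set m | T j (m *+ k)%MM]).
Proof.
move=> k0 [boxT coverT disjT]; split=> [j|m|i j m]; last 2 first.
- exact: coverT.
- exact: disjT.
have [->|[a ->]] := boxT j; first by left.
have [[m0 bm0]|nb] := pselect (exists m0, box a (Z j) (m0 *+ k)%MM).
  by right; apply: box_preimage bm0.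
by left; apply/seteqP; split=> // m bm; apply: nb; exists m.
Qed.

End Boxes.

(** * Projection onto the span of a set of monomials *)

Section Restriction.
Variables (K : fieldType) (n : nat).
Local Notation S := {mpoly K[n]}.
Implicit Types (T E : set 'X_{1..n}) (f : S).

Definition restrict_mpoly T f : S := \sum_(m <- msupp f | `[< T m >]) f@_m *: 'X_[m].

Lemma mcoeff_restrict T f m :
  (restrict_mpoly T f)@_m = if `[< T m >] then f@_m else 0.
Proof.
rewrite raddf_sum /= big_mkcond /=.
have [mf|mf] := boolP (m \in msupp f); last first.
  rewrite memN_msupp_eq0// if_same big_seq big1// => u uf.
  case: ifP => // _; rewrite mcoeffZ mcoeffX; case: eqP => [um|_]; rewrite ?mulr0//.
  by rewrite -um uf in mf.
rewrite (bigD1_seq m) ?msupp_uniq//= big1 ?addr0 => [|u um].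
  by case: ifP; rewrite // mcoeffZ mcoeffX eqxx mulr1.
by case: ifP; rewrite // mcoeffZ mcoeffX (negPf um) mulr0.
Qed.

Lemma supported_restrict T f : supported T (restrict_mpoly T f).
Proof.
by move=> m; rewrite mcoeff_msupp mcoeff_restrict; case: asboolP; rewrite ?eqxx.
Qed.

Lemma supported_restrictC T E f :
  supported (T `|` E) f -> supported E (f - restrict_mpoly T f).
Proof.
move=> TEf m; rewrite mcoeff_msupp mcoeffB mcoeff_restrict.
case: asboolP => [_|Tm]; first by rewrite subrr eqxx.
by rewrite subr0 -mcoeff_msupp => /TEf[].
Qed.

Lemma supported_set1 a f : supported [set a] f -> f = f@_a *: 'X_[a].
Proof.
move=> af; apply/mpolyP => m; rewrite mcoeffZ mcoeffX.
have [->|am] := eqVneq a m; rewrite ?mulr1// mulr0.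
by apply: memN_msupp_eq0; apply: contra am => /af ->.
Qed.

Lemma supported_box_factor a (Z : {set 'I_n}) f : supported (box a Z) f ->
  exists2 v : S, polyZ Z v & f = v * 'X_[a].
Proof.
move=> bf; exists (\sum_(m <- msupp f) f@_m *: 'X_[m - a]).
  rewrite big_seq; apply: (@supported_sum _ _ (mnm_over Z)) => m /bf bm.
  apply: supportedZ; apply/supportedX => i iZ.
  by have [_] := bm i; rewrite mnmBE => ->//; rewrite subnn.
rewrite {1}[f]mpolyE mulr_suml !big_seq; apply: eq_bigr => m /bf bm.
rewrite -scalerAl -mpolyXD submK//.
by apply/mnm_lepP => i; have [] := bm i.
Qed.

End Restriction.

(** * Stanley decompositions as partitions into boxes *)

Section MonomialStanley.
Variables (K : fieldType) (n : nat) (EA EB : set 'X_{1..n}).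
Local Notation S := {mpoly K[n]}.
Local Notation A := (supported EA : set S).
Local Notation B := (supported EB : set S).
Implicit Types (Z : {set 'I_n}) (T : set 'X_{1..n}) (m a : 'X_{1..n}).

Let space := @stanley_space K n S^o (@mpoly_comp K n) A B.
Let span := @stanley_span K n S^o B.

Lemma span_supported a Z (u w : S) : supported [set a] u ->
  span u Z w -> supported (box a Z `|` EB) w.
Proof.
move=> au [v Zv Bwv]; rewrite -[w](subrK (v * u)); apply: supportedD.
  by apply: sub_supported Bwv => m; right.
apply: (supportedM (E1 := mnm_over Z)) au => // z _ Zz ->; left.
by apply/boxP; exists z.
Qed.

Hypothesis upA : forall z m, EA m -> EA (z + m)%MM.
Hypothesis upB : forall z m, EB m -> EB (z + m)%MM.

Lemma supported_mulr p f : B f -> B (p * f).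
Proof. by apply: (@supportedM _ _ setT) => // z m _; apply: upB. Qed.

(** A homogeneous [u] is a scalar times one monomial x^a. If [u] is in [B], the space is zero and
    the empty set serves. Otherwise the box at [a] serves, and freeness keeps it away from [EB]. *)
Lemma stanley_space_box (u : S) Z : space u Z -> exists T,
  [/\ T = set0 \/ exists a, T = box a Z, T `<=` EA `\` EB,
      forall m, T m -> span u Z 'X_[m]
    & forall w, span u Z w -> supported (T `|` EB) w].
Proof.
move=> [Au [b hb] [r [e [_ egen efree]]]].
have [Bu|nBu] := pselect (B u).
  exists set0; split=> //; first by left.
  move=> w [v _ Bwv]; apply: (sub_supported (@subsetUr _ set0 EB)).
  by rewrite -[w](subrK (v * u)); apply: supportedD => //; apply: supported_mulr.
have [a au] : exists a, a \in msupp u.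
  case: (msupp u) (@msuppnil0 _ _ u) => [|a s] u0; last by exists a; apply: mem_head.
  by case: nBu; rewrite u0//; apply: supported0.
have ua : supported [set a] u.
  move=> m mu; apply/mnmP => i; apply/eqP; rewrite -eqz_nat; apply/eqP.
  by rewrite (hb m mu i) (hb a au i).
exists (box a Z); split; first by right; exists a.
- move=> m /boxP[z Zz ->]; split; first exact/upA/Au.
  move=> EBm; apply: nBu.
  have [|c Zc Bc] := egen u.
    by exists 1; [move=> m'; rewrite msupp1 inE => /eqP -> i _; rewrite mnm0E
                 |rewrite scale1r subrr; apply: supported0].
  (* Since x^z annihilates the class of [u], the products x^z c_i form a relation among the basis
     elements, hence vanish. All c_i are then 0, which puts [u] in [B]. *)
  have c0 i : c i = 0.
    have /efree : forall i, polyZ Z ('X_[z] * c i).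
      move=> j; apply: (@supportedM _ _ (mnm_over Z) (mnm_over Z)) (Zc j).
        by move=> z1 z2 Z1 Z2 l lZ; rewrite mnmDE Z1// Z2.
      by apply/supportedX.
    move=> /(_ _ i)/eqP; rewrite mulf_eq0 -msupp_eq0 msuppX /= => zc.
    apply/eqP/zc.
    rewrite (_ : \sum_i _ = 'X_[z] * \sum_i c i * e i); last first.
      by rewrite mulr_sumr; apply: eq_bigr => j _; rewrite mulrA.
    rewrite -[\sum_i _](subKr u) mulrBr; apply: supportedB.
      apply: (@supportedM _ _ [set z] [set a]) ua; first by move=> ? ? -> ->.
      exact/supportedX.
    exact: supported_mulr.
  move: Bc; rewrite big1 ?subr0// => i _; by rewrite c0 scale0r.
- move=> m /boxP[z Zz ->]; exists ((u@_a)^-1 *: 'X_[z]).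
    by apply: (@supportedZ _ _ (mnm_over Z)); apply/supportedX.
  rewrite /= (_ : _ - _ = 0); first exact: supported0.
  apply/eqP; rewrite subr_eq0 {2}(supported_set1 ua); apply/eqP.
  change ('X_[z + a] = ((u@_a)^-1 *: 'X_[z]) * (u@_a *: 'X_[a]) :> S).
  rewrite -scalerAl -scalerAr scalerA mulVf; last by rewrite -mcoeff_msupp.
  by rewrite scale1r mpolyXD.
- by move=> w; apply: span_supported.
Qed.

(* The empty box is realised by the zero Stanley space, which the definition
   admits with any [Z]; this keeps the family of [Z]'s unchanged under pullback. *)
Lemma stanley_space_of_box T Z : T = set0 \/ (exists a, T = box a Z) ->
    T `<=` EA `\` EB -> exists u : S, space u Z /\
    forall w, span u Z w <-> supported (T `|` EB) w.
Proof.
move=> [->|[a ->]] TE.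
  have spanE w : span 0 Z w <-> supported (set0 `|` EB) w.
    rewrite set0U; split=> [[v _]|Bw]; first by rewrite scaler0 subr0.
    exists 0; first by move=> m; rewrite msupp0.
    by rewrite scaler0 subr0.
  exists 0; split=> //; split; first exact: supported0.
    by exists 0 => m; rewrite msupp0.
  exists 0%N, (fun=> 0); split=> [[]//|w /spanE Bw|c _ _ []//].
  by exists (fun=> 0) => [[]//|]; rewrite big_ord0 subr0; rewrite set0U in Bw.
have sX : supported [set a] ('X_[a] : S) by apply/supportedX.
have spanE w : span 'X_[a] Z w <-> supported (box a Z `|` EB) w.
  split=> [|bw]; first exact: span_supported.
  have [v Zv ev] := supported_box_factor (@supported_restrict _ _ (box a Z) w).
  exists v => //; change (B (w - v * 'X_[a])); rewrite -ev.
  exact: supported_restrictC.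
exists 'X_[a]; split=> //; split.
- by apply/supportedX; have [] := TE a (box_corner a Z).
- exists [ffun i => (a i)%:Z] => m; rewrite msuppX inE => /eqP -> i.
  by rewrite ffunE.
exists 1%N, (fun=> 'X_[a]); split=> [_|w [v Zv Bwv]|c Zc].
- by apply/spanE/supportedX; left; apply: box_corner.
- by exists (fun=> v) => //; rewrite big_ord1.
rewrite big_ord1 => Bc i; rewrite ord1.
have bc : supported (box a Z) (c ord0 * 'X_[a]).
  apply: (supportedM (E1 := mnm_over Z)) sX => [z _ Zz ->|]; last exact: Zc.
  by apply/boxP; exists z.
(* The support of this product lies both in the box and in [EB], which are disjoint. *)
have /eqP : c ord0 * 'X_[a] = 0.
  apply/mpolyP => m; rewrite mcoeff0; apply/memN_msupp_eq0/negP => mc.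
  by have [] := TE m (bc m mc) => _; apply; apply: Bc.
by rewrite mulf_eq0 -[in X in _ || X]msupp_eq0 msuppX orbF => /eqP.
Qed.

(** Decomposing x^m itself, with [m] outside [EB], some component has [m] in its support, so the
    boxes cover. They are disjoint by independence of the summands. *)
Lemma stanley_decomposition_boxes r (D : 'I_r -> S * {set 'I_n}) :
    @stanley_decomposition K n S^o (@mpoly_comp K n) A B r D ->
  exists T : 'I_r -> set 'X_{1..n}, box_partition (EA `\` EB) (fun j => (D j).2) T.
Proof.
move=> [spaceD coverD indepD].
have /choice[T hT] := fun j => stanley_space_box (spaceD j).
exists T; split=> [j|m|i j m Tim Tjm]; first by have [] := hT j.
  split=> [[Am nBm]|[j Tjm]]; last by have [_ + _ _] := hT j; apply.
  have [w spanw Bxw] := coverD 'X_[m] (iffRL (supportedX K EA m) Am).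
  have [nw|] := pselect (forall j, (w j)@_m = 0); last first.
    move=> /existsNP[j /eqP]; rewrite -mcoeff_msupp => mw; exists j.
    by have [_ _ _ /(_ _ (spanw j) m mw)[]] := hT j.
  case: nBm; apply: Bxw.
  rewrite mcoeff_msupp mcoeffB mcoeffX eqxx raddf_sum big1 ?subr0 ?oner_neq0//.
  by move=> j _; apply: nw.
have [//|ij] := eqVneq i j; exfalso.
(* A monomial common to two boxes gives the relation x^m - x^m = 0 between two summands. *)
pose w l : S := if l == i then 'X_[m] else if l == j then - 'X_[m] else 0.
have Xspan l : T l m -> span (D l).1 (D l).2 'X_[m] by have [_ _ + _] := hT l; apply.
have spanw l : span (D l).1 (D l).2 (w l).
  rewrite /w; have [->|li] := eqVneq l i; first exact: Xspan.
  have [->|lj] := eqVneq l j.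
    have [v Zv Bv] := Xspan j Tjm; exists (- v).
      exact: (@supportedN _ _ (mnm_over (D j).2)).
    by rewrite scaleNr -opprD; apply: supportedN.
  exists 0; first exact: (@supported0 _ _ (mnm_over (D l).2)).
  by rewrite scale0r subr0; apply: supported0.
have : B (w i).
  apply: (indepD w spanw); rewrite (bigD1 i)//= (bigD1 j) 1?eq_sym//= big1.
    rewrite /w eqxx [j == i]eq_sym (negPf ij) eqxx addr0 subrr.
    exact: supported0.
  by move=> l /andP[li lj]; rewrite /w (negPf li) (negPf lj).
rewrite /w eqxx => /supportedX.
by have [_ /(_ m Tim)[]] := hT i.
Qed.

(** The components of an element are its restrictions to the boxes. They are independent modulo [B]
    because a monomial outside [EB] occurs in at most one summand. *)
Lemma boxes_stanley_decomposition r (Z : 'I_r -> {set 'I_n})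
    (T : 'I_r -> set 'X_{1..n}) :
    box_partition (EA `\` EB) Z T -> exists D : 'I_r -> S * {set 'I_n},
  @stanley_decomposition K n S^o (@mpoly_comp K n) A B r D /\
    forall j, (D j).2 = Z j.
Proof.
move=> [boxT coverT disjT].
have TE j : T j `<=` EA `\` EB by move=> m Tm; apply/coverT; exists j.
have /choice[u hu] := fun j => stanley_space_of_box (boxT j) (TE j).
exists (fun j => (u j, Z j)); split=> //; split=> [j|x Ax|w spanw Bw j m mw] /=.
- by have [] := hu j.
- exists (fun j => restrict_mpoly (T j) x) => [j|m].
    apply/(hu j).2; apply: sub_supported (@supported_restrict _ _ (T j) x).
    exact: subsetUl.
  apply: contraTP => nBm; rewrite mcoeff_msupp negbK mcoeffB raddf_sum /=.
  under eq_bigr do rewrite mcoeff_restrict.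
  have [x0|] := eqVneq x@_m 0.
    by rewrite x0 big1 ?subrr// => j _; rewrite if_same.
  rewrite -mcoeff_msupp => /Ax Am; have /coverT[j Tjm] : (EA `\` EB) m by [].
  rewrite (bigD1 j)//= asboolT// big1 ?addr0 ?subrr// => i ij.
  by case: asboolP => // Tim; rewrite (disjT _ _ _ Tim Tjm) eqxx in ij.
- have suppw i : m \in msupp (w i) -> T i m \/ EB m.
    by move=> mi; have /(hu i).2 := spanw i; apply.
  have [Tjm|//] := suppw j mw; apply: Bw.
  rewrite mcoeff_msupp raddf_sum /= (bigD1 j)//= big1 ?addr0 -?mcoeff_msupp//.
  move=> i ij; apply: memN_msupp_eq0; apply/negP => /suppw[Tim|].
    by rewrite (disjT _ _ _ Tim Tjm) eqxx in ij.
  by have [_] := TE j m Tjm.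
Qed.

End MonomialStanley.

(** * Attained extrema and the comparison of Stanley depths *)

(** Depths take values in a finite list, so this ensures that [emax] and, by duality, [emin] of
    nonempty sets of depths are attained and not default values. *)
Lemma set_max_in_seq (disp : Order.disp_t) (T : orderType disp) (X : set T)
    (s : seq T) :
  (forall x, X x -> x \in s) -> (exists x, X x) -> exists x, (X `&` ubound X) x.
Proof.
elim: s X => [|a s IHs] X Xs [x0 Xx0]; first by have := Xs x0 Xx0.
have [[x1 [Xx1 x1a]]|Xa] := pselect (exists x, X x /\ x != a); last first.
  have Xxa x : X x -> x = a.
    by move=> Xx; apply: contrapT => /eqP xa; apply: Xa; exists x.
  by exists x0; split=> // y /Xxa ->; rewrite (Xxa x0).
have [||x [[Xx xa] xmax]] := IHs [set x | X x /\ x != a].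
- by move=> x [/Xs + /negPf xa]; rewrite inE xa.
- by exists x1.
have [[Xa ax]|nXa] := pselect (X a /\ (x <= a)%O).
  exists a; split=> // y Xy; have [->//|ya] := eqVneq y a.
  exact: le_trans (xmax y (conj Xy ya)) ax.
exists x; split=> // y Xy; have [ya|ya] := eqVneq y a; last exact: xmax.
by rewrite leNgt; apply/negP => /ltW xy; apply: nXa; rewrite -ya.
Qed.

Lemma set_min_in_seq (disp : Order.disp_t) (T : orderType disp) (X : set T)
    (s : seq T) :
  (forall x, X x -> x \in s) -> (exists x, X x) -> exists x, (X `&` lbound X) x.
Proof. exact: (@set_max_in_seq _ T^d). Qed.

Section DepthValues.
Variables (K : fieldType) (n : nat).
Local Notation S := {mpoly K[n]}.

(* [-oo] is the default value of [emax]. *)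
Definition depth_values : seq (\bar int) :=
  [:: -oo%E, +oo%E & [seq (k%:Z)%:E | k <- index_iota 0 n.+1]].

Lemma sdepth_decomposition_values (M : lmodType S) r (D : 'I_r -> M * {set 'I_n}) :
  sdepth_decomposition D \in depth_values.
Proof.
rewrite /sdepth_decomposition.
elim/big_rec: _ => [|j x _ xv]; first by rewrite !inE eqxx orbT.
rewrite minEle; case: ifP => // _; rewrite 2!in_cons; apply/orP; right.
apply/orP; right; apply: (map_f (fun k => (k%:Z)%:E)).
by rewrite mem_index_iota /= ltnS; have := max_card (mem (D j).2); rewrite card_ord.
Qed.

Lemma emax_values (X : set (\bar int)) :
  (forall x, X x -> x \in depth_values) -> emax X \in depth_values.
Proof. by move=> Xv; rewrite /emax; case: xgetP => [x _ [/Xv]|]. Qed.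

Lemma le_emax (X Y : set (\bar int)) : (forall y, Y y -> y \in depth_values) ->
  X `<=` Y -> (emax X <= emax Y)%E.
Proof.
(* If [X] has no greatest element, [emax X] is the default -oo and the bound is trivial; otherwise
   [Y] is nonempty and its maximum is attained. *)
move=> Yv XY; rewrite {1}/emax; case: xgetP => [x _ [Xx _]|_]; last exact: leNye.
have [_] : (Y `&` ubound Y) (emax Y).
  by apply: xgetPex; apply: set_max_in_seq Yv _; exists x; apply: XY.
by apply; apply: XY.
Qed.

Lemma emin_le (X : set (\bar int)) x : (forall y, X y -> y \in depth_values) ->
  X x -> (emin X <= x)%E.
Proof.
move=> Xv Xx; have [_] : (X `&` lbound X) (emin X).
  by apply: xgetPex; apply: set_min_in_seq Xv _; exists x.
exact.
Qed.

Lemma sdepth_values (A B : set S) :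
  @sdepth K n S^o (@mpoly_comp K n) A B \in depth_values.
Proof.
by apply: emax_values => d [r [D [_ ->]]]; apply: sdepth_decomposition_values.
Qed.

(** A decomposition becomes a box partition, is pulled back along m -> km, and becomes a
    decomposition again with the same sets [Z]. Every depth on the left thus occurs on the right. *)
Lemma sdepth_preimage (EA EB : set 'X_{1..n}) k : (0 < k)%N ->
    (forall z m, EA m -> EA (z + m)%MM) -> (forall z m, EB m -> EB (z + m)%MM) ->
  (@sdepth K n S^o (@mpoly_comp K n) (supported EA) (supported EB) <=
   @sdepth K n S^o (@mpoly_comp K n)
     (supported [set m | EA (m *+ k)%MM]) (supported [set m | EB (m *+ k)%MM]))%E.
Proof.
move=> k0 upA upB; apply: le_emax.
  by move=> d [r [D [_ ->]]]; apply: sdepth_decomposition_values.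
move=> d [r [D [decD ->]]].
have [T partT] := stanley_decomposition_boxes upA upB decD.
have [D' [decD' D'Z]] :=
  boxes_stanley_decomposition K (box_partition_preimage k0 partT).
exists r, D'; split=> //; rewrite /sdepth_decomposition.
by apply: eq_bigr => j _; rewrite D'Z.
Qed.

End DepthValues.

Theorem corollary2p13 (K : fieldType) (n : nat) (I : set {mpoly K[n]})
    (hI : monomial_ideal I) :
  (emin [set sdepth_quotient (ideal_exp I k) | k in [set k | (1 <= k)%N]]%classic
     <= sdepth_quotient (integral_closure I))%E /\
  (emin [set sdepth_ideal (ideal_exp I k) | k in [set k | (1 <= k)%N]]%classic
     <= sdepth_ideal (integral_closure I))%E.
Proof.
have [k k0 ->] := integral_closure_supported hI.
have upI := @exp_monomials_addl K n I k.
(* The minimum is at most the value at the [k] just found. The quotient is the case where [EA] is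
   [setT], the ideal the case where [EB] is [set0]. *)
split; apply: (@le_trans _ _ _ _ _ (emin_le _ (ex_intro2 _ _ k k0 erefl))).
- by move=> _ [j _ <-]; apply: sdepth_values.
- rewrite /sdepth_quotient ideal_exp_supported// -supportedT.
  exact: (@sdepth_preimage K n setT).
- by move=> _ [j _ <-]; apply: sdepth_values.
- rewrite /sdepth_ideal ideal_exp_supported// -supported_set0.
  exact: (@sdepth_preimage K n _ set0).
Qed.
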